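(* Let $\mathscr{G}$ be a Lie group with Lie algebra $\mathfrak{g}$, equipped with a right-invariant metric $\langle\cdot,\cdot\rangle$ admitting a smooth Riemannian exponential map $\exp_e\colon\mathcal{U}\subset\mathfrak{g}\to\mathscr{G}$ that is a diffeomorphism from a neighborhood of $0\in\mathfrak{g}$ onto a neighborhood of $e\in\mathscr{G}$. Let $X\in\mathfrak{g}$ be such that $$\mathrm{ad}^\star_X=-\mathrm{ad}_X$$ and denote its flow by $\gamma_X$. Then a curve in $\mathfrak{g}$ given by $$U(t)=X+\mathrm{Ad}_{\gamma_X(t)}V(t)$$ solves the Euler–Arnold equation $\partial_tU=-\mathrm{ad}^\star_UU$ if and only if $V(t)$ solves $$\partial_tV=-\mathrm{ad}^\star_VV-\mathrm{ad}^\star_VX.$$ Moreover, $U$ is stationary if and only if $$\partial_tV=\mathrm{ad}^\star_XV.$$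
   Context: For $\sigma\in\mathscr{G}$, $R_\sigma,L_\sigma$ are right and left translation, $\mathrm{Ad}_\sigma v=d_\sigma R_{\sigma^{-1}}\,d_eL_\sigma\,v$, and $\mathrm{ad}_uv=\frac{d}{dt}\big|_{t=0}\mathrm{Ad}_{\sigma(t)}v$ for any smooth curve $\sigma$ with $\sigma(0)=e$, $\dot\sigma(0)=u$. The inner product on $\mathfrak{g}$ is extended to a right-invariant metric on $\mathscr{G}$ by right translation. The coadjoint operators are defined by $\langle\mathrm{Ad}^\star_\sigma u,v\rangle=\langle u,\mathrm{Ad}_\sigma v\rangle$ and $\langle\mathrm{ad}^\star_uv,w\rangle=\langle v,\mathrm{ad}_uw\rangle$ (assumed to exist). The flow $\gamma_X$ of $X\in\mathfrak{g}$ is the curve in $\mathscr{G}$ with $\gamma_X(0)=e$ and $\dot\gamma_X(t)=d_eR_{\gamma_X(t)}X$. Stationary means independent of $t$. *)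

(* Defs.v *)
From HB Require Import structures.
From mathcomp Require Import all_boot all_order all_algebra.
From mathcomp Require Import all_classical all_reals all_analysis.

Set Implicit Arguments.
Unset Strict Implicit.
Unset Printing Implicit Defensive.

Import Order.TTheory GRing.Theory Num.Theory.
Import numFieldTopology.Exports.

Local Open Scope classical_set_scope.
Local Open Scope ring_scope.

(** * Differential calculus in locally convex spaces

    The library's [derive] and [differentiable] require normed modules. Lie
    groups such as diffeomorphism groups are modelled on locally convex spaces
    that need not be normable, so smoothness is taken in the sense of Michal
    and Bastiani (for Frechet spaces: Hamilton). *)

Definition is_dderiv (R : realType) (E F : tvsType R) (f : E -> F) (x v : E)
    (l : F) : Prop :=
  (fun h : R => h^-1 *: (f (x + h *: v) - f x)) @ (0 : R)^' --> l.

(** The default value 0 is returned when no directional derivative exists. *)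
Definition dderiv (R : realType) (E F : tvsType R) (f : E -> F) (x v : E) : F :=
  xget 0 [set l | is_dderiv f x v l].

(** Class C^k on an open set [A]: [f] is C^(k+1) when it is continuous, has all
    directional derivatives, and [(x, v) |-> df(x) v] is C^k on [A x E]. *)
Fixpoint Ck (R : realType) (F : tvsType R) (k : nat) :
    forall E : tvsType R, set E -> (E -> F) -> Prop :=
  fun E A f =>
    (forall x, A x -> {for x, continuous f}) /\
    match k with
    | 0 => True
    | k'.+1 =>
        (forall x v, A x -> exists l, is_dderiv f x v l) /\
        @Ck R F k' (E * E)%type (A `*` setT) (fun p => dderiv f p.1 p.2)
    end.

Definition Cinfty (R : realType) (E F : tvsType R) (A : set E) (f : E -> F) :
  Prop := forall k, Ck k A f.

(** Derivative at time [t] of a curve in a vector space. *)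
Definition has_deriv (R : realType) (F : tvsType R) (c : R -> F) (t : R)
  (l : F) : Prop := is_dderiv (c : R^o -> F) t 1 l.

(** * Smooth manifolds

    An atlas is presented with one preferred chart around each point: charts
    are total functions, meaningful on [cdom x] and, for the inverse, on
    [ctgt x]. *)

Record charts (R : realType) (E : tvsType R) (M : topologicalType) := Charts {
  cdom : M -> set M;
  ctgt : M -> set E;
  chart : M -> M -> E;
  chart_inv : M -> E -> M }.

Record smooth_manifold (R : realType) (E : tvsType R) (M : topologicalType)
    (c : charts E M) : Prop := {
  model_hausdorff : hausdorff_space E;
  manifold_hausdorff : hausdorff_space M;
  cdom_open : forall x, open (cdom c x);
  ctgt_open : forall x, open (ctgt c x);
  cdom_mem : forall x, cdom c x x;
  chart_maps : forall x y, cdom c x y -> ctgt c x (chart c x y);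
  chart_inv_maps : forall x z, ctgt c x z -> cdom c x (chart_inv c x z);
  chartK : forall x y, cdom c x y -> chart_inv c x (chart c x y) = y;
  chart_invK : forall x z, ctgt c x z -> chart c x (chart_inv c x z) = z;
  chart_continuous : forall x y, cdom c x y -> {for y, continuous (chart c x)};
  chart_inv_continuous :
    forall x z, ctgt c x z -> {for z, continuous (chart_inv c x)};
  transition_smooth : forall x y,
    Cinfty (ctgt c x `&` [set z | cdom c y (chart_inv c x z)])
           (chart c y \o chart_inv c x) }.

Definition tvs_charts (R : realType) (E : tvsType R) : charts E E :=
  Charts (fun=> setT) (fun=> setT) (fun=> id) (fun=> id).

Definition prod_charts (R : realType) (E F : tvsType R)
    (M N : topologicalType) (c : charts E M) (d : charts F N) :
    charts (E * F)%type (M * N)%type :=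
  Charts (fun x : M * N => cdom c x.1 `*` cdom d x.2)
         (fun x : M * N => ctgt c x.1 `*` ctgt d x.2)
         (fun x y : M * N => (chart c x.1 y.1, chart d x.2 y.2))
         (fun (x : M * N) (z : E * F) =>
            (chart_inv c x.1 z.1, chart_inv d x.2 z.2)).

(** Smoothness of [f] on an open set [D]: continuity, and C^infinity regularity
    of all its local representatives. *)
Definition smooth_on (R : realType) (E F : tvsType R) (M N : topologicalType)
    (c : charts E M) (d : charts F N) (D : set M) (f : M -> N) : Prop :=
  (forall p, D p -> {for p, continuous f}) /\
  (forall x y,
    Cinfty (ctgt c x `&` [set z | D (chart_inv c x z) /\
                                  cdom d y (f (chart_inv c x z))])
           (chart d y \o f \o chart_inv c x)).

(** The tangent space at [p] is the model space, a tangent vector being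
    represented by its coordinates in the preferred chart at [p]. *)
Definition tangent_space (R : realType) (E : tvsType R) (M : topologicalType)
  (c : charts E M) (p : M) : tvsType R := E.

Definition tangent_map (R : realType) (E F : tvsType R)
    (M N : topologicalType) (c : charts E M) (d : charts F N) (f : M -> N)
    (p : M) (v : tangent_space c p) : tangent_space d (f p) :=
  dderiv (chart d (f p) \o f \o chart_inv c p) (chart c p p) v.

(** Continuity is required separately because [chart c (g t)] is meaningless
    outside its domain. *)
Definition has_velocity (R : realType) (E : tvsType R) (M : topologicalType)
    (c : charts E M) (g : R -> M) (t : R) (v : tangent_space c (g t)) : Prop :=
  {for t, continuous g} /\ has_deriv (chart c (g t) \o g) t v.

Definition velocity (R : realType) (E : tvsType R) (M : topologicalType)
    (c : charts E M) (g : R -> M) (t : R) : tangent_space c (g t) :=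
  @tangent_map R R^o E R^o M (tvs_charts R^o) c g t 1.

(** * Lie groups *)

HB.mixin Record isLieGroup (R : realType) (E : tvsType R) G
    of Topological G & Group G := {
  lie_charts : charts E G;
  lie_manifold : smooth_manifold lie_charts;
  mulg_smooth : smooth_on (prod_charts lie_charts lie_charts) lie_charts setT
                  (fun p : G * G => (p.1 * p.2)%g);
  invg_smooth : smooth_on lie_charts lie_charts setT (fun x : G => (x^-1)%g) }.

#[short(type="lieGroupType")]
HB.structure Definition LieGroup (R : realType) (E : tvsType R) :=
  {G of isLieGroup R E G & Topological G & Group G}.

Section LieGroupTheory.
Context (R : realType) (E : tvsType R) (G : lieGroupType E).

Local Notation c := (@lie_charts R E G).
Local Notation T := (tangent_space c).

Definition lie_algebra : tvsType R := T 1%g.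
Local Notation g := lie_algebra.

Definition ltrans (s : G) : G -> G := fun x => (s * x)%g.
Definition rtrans (s : G) : G -> G := fun x => (x * s)%g.

(** The target chart of [tangent_map] is the preferred one at [s * s^-1], which
    is the one at 1. *)
Definition Ad (s : G) (v : g) : g :=
  @tangent_map R E E G G c c (rtrans s^-1%g) s
    (@tangent_map R E E G G c c (ltrans s) 1%g v).

Definition smooth_curve_near (s : R -> G) (t : R) : Prop :=
  exists2 D : set R^o, open_nbhs t D & smooth_on (tvs_charts R^o) c D s.

Definition ad (u v : g) : g :=
  xget 0 [set w | forall s : R -> G, smooth_curve_near s 0 -> s 0 = 1%g ->
                    @has_velocity R E G c s 0 u ->
                    has_deriv (fun t => Ad (s t) v) 0 w].

(** Continuity is with respect to the topology of [g], which the inner product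
    need not generate (weak Riemannian metrics are allowed). *)
Record inner_product (ip : g -> g -> R) : Prop := {
  ip_sym : forall u v, ip u v = ip v u;
  ip_linear : forall a u v w, ip (a *: u + v) w = a * ip u w + ip v w;
  ip_pos : forall u, u != 0 -> 0 < ip u u;
  ip_continuous : continuous (fun p : g * g => ip p.1 p.2) }.

(** The right-invariant metric extending [ip]. *)
Definition rmetric (ip : g -> g -> R) (s : G) (v w : T s) : R :=
  ip (@tangent_map R E E G G c c (rtrans s^-1%g) s v)
     (@tangent_map R E E G G c c (rtrans s^-1%g) s w).

Definition energy (ip : g -> g -> R) (eta : R -> G) : R :=
  2^-1 * \int[lebesgue_measure]_(t in `[0, 1])
    rmetric ip (velocity c eta t) (velocity c eta t).

(** [H] is a smooth variation of [eta] on [0, 1] with fixed endpoints; its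
    parameter is the first argument. *)
Definition proper_variation (eta : R -> G) (H : R -> R -> G) : Prop :=
  [/\ exists2 D : set (R^o * R^o)%type,
        open D /\ (forall t : R, t \in `[0, 1] -> D (0, t)) &
        smooth_on (tvs_charts (R^o * R^o)%type) c D (fun p => H p.1 p.2),
      forall t, t \in `[0, 1] -> H 0 t = eta t &
      \forall s \near (0 : R), H s 0 = eta 0 /\ H s 1 = eta 1].

(** Geodesics on [0, 1] as critical points of the energy. *)
Definition geodesic (ip : g -> g -> R) (eta : R -> G) : Prop :=
  (exists2 D : set R^o, open D /\ (forall t : R, t \in `[0, 1] -> D t) &
     smooth_on (tvs_charts R^o) c D eta) /\
  (forall H, proper_variation eta H ->
     has_deriv (fun s => energy ip (H s) : R^o) 0 0).

Definition geodesic_from (ip : g -> g -> R) (u : g) (eta : R -> G) : Prop :=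
  [/\ geodesic ip eta, eta 0 = 1%g & @has_velocity R E G c eta 0 u].

(** [ex u] is the value at time 1 of the geodesic with initial velocity [u]. *)
Definition riemannian_exp (ip : g -> g -> R) (U : set g) (ex : g -> G) : Prop :=
  [/\ open U, U 0 &
    forall u, U u -> (exists2 eta, geodesic_from ip u eta & eta 1 = ex u) /\
                     (forall eta, geodesic_from ip u eta -> eta 1 = ex u)].

Definition local_diffeo_at0 (U : set g) (ex : g -> G) : Prop :=
  exists (W : set g) (lg : G -> g),
    [/\ open W, W 0, W `<=` U, open (ex @` W) & (ex @` W) 1%g] /\
    [/\ forall u, W u -> lg (ex u) = u,
        smooth_on (tvs_charts g) c W ex &
        smooth_on c (tvs_charts g) (ex @` W) lg].

Definition is_flow (X : g) (J : set R) (gam : R -> G) : Prop :=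
  gam 0 = 1%g /\
  forall t, J t ->
    @has_velocity R E G c gam t
      (@tangent_map R E E G G c c (rtrans (gam t)) 1%g X).

Definition is_coAd (ip : g -> g -> R) (coAd : G -> g -> g) : Prop :=
  forall s u v, ip (coAd s u) v = ip u (Ad s v).

Definition is_coad (ip : g -> g -> R) (coad : g -> g -> g) : Prop :=
  forall u v w, ip (coad u v) w = ip v (ad u w).

End LieGroupTheory.

Definition open_interval (R : realType) (I : set R) : Prop :=
  open I /\ is_interval I.

Definition solves_on (R : realType) (F : tvsType R) (I : set R)
    (rhs : F -> F) (W : R -> F) : Prop :=
  forall t, I t -> has_deriv W t (rhs (W t)).

Definition stationary_on (R : realType) (F : Type) (I : set R) (W : R -> F) :
  Prop := forall s t, I s -> I t -> W s = W t.

(* Main.v *)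
Require Import Defs.
From mathcomp Require Import all_boot all_order all_algebra.
From mathcomp Require Import all_classical all_reals all_analysis.
From mathcomp Require Import lra ring.

Set Implicit Arguments.
Unset Strict Implicit.
Unset Printing Implicit Defensive.

Import Order.TTheory GRing.Theory Num.Theory.
Import numFieldTopology.Exports.

Local Open Scope classical_set_scope.
Local Open Scope ring_scope.

(** Write [U = X + W] with [W = Ad_gamma V]. Since
    [gamma (t + h) = sigma h * gamma t] with [sigma' 0 = X], the product rule
    gives [W' = ad_X W + Ad_gamma V'], and [V] is differentiable iff [U] is.
    The hypothesis makes [ad_X] skew, so [Ad_gamma] is an isometry; as
    [Ad] intertwines [ad], it intertwines [coad]. The flow of [X] is locally a
    one-parameter group (the curve [gamma s ^-1 * gamma (s + t)] of [s] has zero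
    velocity), so [ad_X X = 0] and, by skewness, [Ad_gamma X = X]. Both claims
    then follow by applying [Ad_gamma^-1] to the equations for [U].

    On the analytic side everything rests on a mean value theorem in locally
    convex spaces: a difference quotient of a curve lies in every open convex
    set containing all its derivatives. It makes C^1 maps strictly
    differentiable, which yields the chain rule along curves that are only
    differentiable at one point, and the linearity of the derivative. *)

(** * Calculus in locally convex spaces *)

Section MeanValue.
Context (R : realType) (F : tvsType R).
Implicit Types (c : R -> F) (B : set F).

Definition is_convex B := forall (x y : F) (k : R),
  B x -> B y -> 0 < k -> k < 1 -> B (k *: x + (1 - k) *: y).

(** Local convexity of the space supplies a base of open convex sets; the weights of the library's
    convexity become plain inequalities on [k]. *)
Lemma convex_open_nbhs (x : F) (N : set F) : nbhs x N ->
  exists B, [/\ open B, B x, B `<=` N & is_convex B].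
Proof.
have [S Scv [So Sb]] := @locally_convex R F.
move=> /(Sb x)[B [SB Bx] BN]; exists B; split=> //; first exact: So.
move=> y z k By Bz k0 k1.
have k01 : (0 <= k <= 1) by rewrite !ltW.
have := Scv B (mem_set SB) y z (Itv01 (ltW k0) (ltW k1)) (mem_set By) (mem_set Bz).
by rewrite inE.
Qed.

Lemma has_derivP c t l (N : set F) : has_deriv c t l -> nbhs l N ->
  exists2 e : R, 0 < e &
    forall h, h != 0 -> `|h| < e -> N (h^-1 *: (c (t + h) - c t)).
Proof.
move=> cl /cl; rewrite /= nbhs_simpl /dnbhs /within /= => /nbhs_ballP[e e0 He].
exists e => // h h0 he.
have := He h _ h0; rewrite /ball /= sub0r normrN => /(_ he).
by rewrite /GRing.scale/= mulr1.
Qed.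

(** A supremum argument. The quotient over an interval cut in two is a convex combination of the
    quotients over the pieces, and differentiability at [s] puts the quotients over short intervals
    around [s] in [B]. *)
Lemma mean_value_convex c (B : set F) (a b : R) : a < b -> open B ->
    is_convex B ->
    (forall s, a <= s <= b -> exists2 l, has_deriv c s l & B l) ->
  B ((b - a)^-1 *: (c b - c a)).
Proof.
move=> ab oB cB dc.
(* The premise [u < v] makes degenerate intervals trivially good, so the set [S] below contains
   [a]. *)
pose P u v := u < v -> B ((v - u)^-1 *: (c v - c u)).
(* The weights are the relative lengths [(v - u) / (w - u)] and [(w - v) / (w - u)]. *)
have Ptrans u v w : u <= v -> v <= w -> P u v -> P v w -> P u w.
  rewrite le_eqVlt => /predU1P[->//|uv].
  rewrite le_eqVlt => /predU1P[<-//|vw] Puv Pvw uw.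
  have := cB _ _ ((v - u) / (w - u)) (Puv uv) (Pvw vw).
  rewrite ltr_pdivrMr ?subr_gt0// mul1r ltrD2r vw divr_gt0 ?subr_gt0//.
  move=> /(_ isT isT).
  congr (B _).
  have -> : 1 - (v - u) / (w - u) = (w - v) / (w - u).
    by field; rewrite subr_eq0 gt_eqF.
  rewrite !scalerA ![_ / (w - u)]mulrC -![_ * _ * _^-1]mulrA.
  rewrite !divff ?subr_eq0 ?gt_eqF// !mulr1 -scalerDr.
  by congr (_ *: _); rewrite addrC addrA subrK.
have Ploc s : a <= s <= b -> exists2 e : R, 0 < e &
    forall u v, s - e < u -> u <= s -> s <= v -> v < s + e -> P u v.
  move=> /dc[l cl Bl].
  have [e e0 He] := has_derivP cl (open_nbhs_nbhs (conj oB Bl)).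
  exists e => // u v eu us sv ve; apply: (Ptrans u s v) => //.
    move=> {}us; have := He (u - s).
    rewrite subr_eq0 lt_eqF// => /(_ isT).
    rewrite ltr0_norm ?subr_lt0// => /(_ ltac:(lra)).
    rewrite (addrC s) subrK -[u - s]opprB invrN scaleNr -scalerN.
    by rewrite opprB.
  move=> {}sv; have := He (v - s).
  rewrite subr_eq0 gt_eqF// => /(_ isT).
  rewrite gtr0_norm ?subr_gt0// => /(_ ltac:(lra)).
  by rewrite (addrC s) subrK.
(* By [Ploc] at [sup S], the interval from [a] to any point slightly beyond [sup S] is still good,
   which forces [sup S = b]. *)
pose S := [set x : R | a <= x <= b /\ P a x].
have Sa : S a by split; [rewrite lexx ltW|rewrite /P ltxx].
have hS : has_sup S by split; [exists a | exists b => x [/andP[]]].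
have am : a <= sup S by apply: (sup_upper_bound hS).
have mb : sup S <= b by apply: ge_sup; [exists a | move=> x [/andP[]]].
have [e e0 He] := Ploc (sup S) (introT andP (conj am mb)).
have [x Sx ex] := sup_adherent e0 hS.
have xm : x <= sup S by apply: (sup_upper_bound hS).
have [/andP[ax xb] Pax] := Sx.
have Pm v : sup S <= v -> v < sup S + e -> P a v.
  by move=> mv ve; apply: (Ptrans a x v) => //; [lra|exact: He].
have [bS|bm] := eqVneq b (sup S); first by apply: (Pm b) => //; lra.
 have {}mb : sup S < b by rewrite lt_neqAle eq_sym bm mb.
pose v := Num.min b (sup S + e / 2).
have mv : sup S < v by rewrite lt_min mb ltrDl divr_gt0.
have vb : v <= b by rewrite ge_min lexx.
have ve : v < sup S + e by rewrite gt_min orbC ltrD2l; lra.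
have /(sup_upper_bound hS) : S v.
  by split; [lra|apply: Pm => //; exact: ltW].
by rewrite leNgt mv.
Qed.

End MeanValue.

(** * Limits of sums and multiples *)

Section TvsLimits.
Context (R : realType) (E : tvsType R) (T : Type) (F : set_system T).
Context {FF : Filter F}.
Implicit Types (f g : T -> E).

Lemma tvs_cvgD f g (a b : E) : f @ F --> a -> g @ F --> b ->
  (fun x => f x + g x) @ F --> a + b.
Proof.
move=> fa gb.
exact: (@continuous2_cvg _ _ _ _ _ FF f g (@GRing.add E) _ _
  (@add_continuous E (a, b)) fa gb).
Qed.

Lemma tvs_cvgZ (k : T -> R^o) f (r : R^o) (a : E) : k @ F --> r -> f @ F --> a ->
  (fun x => k x *: f x) @ F --> r *: a.
Proof.
move=> kr fa.
exact: (@continuous2_cvg _ R^o _ _ _ FF k f (@GRing.scale R E) _ _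
  (@scale_continuous _ E (r, a)) kr fa).
Qed.

End TvsLimits.

(** * Derivatives of curves, strict differentiability and the chain rule *)

Section Derivatives.
Context (R : realType).
Implicit Types (E F : tvsType R).

Lemma cvg_dnbhs0 : (fun h : R => h : R^o) @ (0 : R)^' --> (0 : R^o).
Proof. exact: nbhs_dnbhs. Qed.

Lemma dnbhs0_cvg_eq F (f g : R -> F) (l : F) :
  (forall h, h != 0 -> f h = g h) -> f @ (0 : R)^' --> l -> g @ (0 : R)^' --> l.
Proof.
move=> fg fl; apply: (cvg_trans _ fl); apply: near_eq_cvg; near=> h.
by apply: fg; near: h; exact: nbhs_dnbhs_neq.
Unshelve. all: by end_near. Qed.

Lemma has_deriv_cvg F (c : R -> F) (t : R) (l : F) :
  has_deriv c t l <-> (fun h => h^-1 *: (c (t + h) - c t)) @ (0 : R)^' --> l.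
Proof.
rewrite /has_deriv /is_dderiv.
suff -> : (fun h : R => h^-1 *: (c (t + h *: (1 : R^o)) - c t)) =
          (fun h : R => h^-1 *: (c (t + h) - c t)) by [].
by apply/funext => h; rewrite /GRing.scale/= mulr1.
Qed.

Lemma has_deriv_shift F (c : R -> F) (t : R) (l : F) :
  has_deriv c t l <-> has_deriv (fun h => c (t + h)) 0 l.
Proof.
rewrite !has_deriv_cvg.
suff -> : (fun h : R => h^-1 *: (c (t + (0 + h)) - c (t + 0))) =
          (fun h : R => h^-1 *: (c (t + h) - c t)) by [].
by apply/funext => h; rewrite add0r addr0.
Qed.

Lemma has_deriv_unique F (c : R -> F) t l l' : hausdorff_space F ->
  has_deriv c t l -> has_deriv c t l' -> l = l'.
Proof. by move=> hF; apply: cvg_unique. Qed.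

Lemma has_deriv_near F (c d : R -> F) t l : (\forall s \near t, c s = d s) ->
  has_deriv c t l -> has_deriv d t l.
Proof.
move=> cd; rewrite !has_deriv_cvg => cl.
apply: (cvg_trans _ cl); apply: near_eq_cvg.
have cdt : \forall h \near (0 : R)^', c (t + h) = d (t + h).
  apply: nbhs_dnbhs; have : (fun h : R => t + h) @ (0 : R) --> t.
    rewrite -[X in _ --> X]addr0.
    exact: (@tvs_cvgD R R^o _ _ _ (fun=> t) id t 0 (cvg_cst _) cvg_id).
  by move=> /(_ _ cd).
have ct := nbhs_singleton cd.
by near=> h; rewrite ct; congr (_ *: (_ - _)); near: h.
Unshelve. all: by end_near. Qed.

Lemma has_deriv_cst F (a : F) t : has_deriv (fun=> a) t 0.
Proof.
rewrite has_deriv_cvg; under eq_fun do rewrite subrr scaler0.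
exact: cvg_cst.
Qed.

Lemma has_deriv_pair E F (c : R -> E) (d : R -> F) t l m :
  has_deriv c t l -> has_deriv d t m ->
  has_deriv (fun s => (c s, d s)) t ((l, m) : (E * F)%type).
Proof. by rewrite !has_deriv_cvg => cl dm; exact: (cvg_pair cl dm). Qed.

Lemma has_derivD F (c d : R -> F) t l m : has_deriv c t l -> has_deriv d t m ->
  has_deriv (fun s => c s + d s) t (l + m).
Proof.
rewrite !has_deriv_cvg => cl dm.
apply: (dnbhs0_cvg_eq _ (tvs_cvgD cl dm)) => h _.
by rewrite -scalerDr opprD addrACA.
Qed.

Lemma has_deriv_line E (x v : E) t : has_deriv (fun s => x + s *: v) t v.
Proof.
rewrite has_deriv_cvg; apply: (dnbhs0_cvg_eq _ (cvg_cst v)) => h h0.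
by rewrite scalerDl addrA [_ + h *: v]addrC addrK scalerA mulVf// scale1r.
Qed.

Lemma has_deriv_cvg0 F (c : R -> F) t l : has_deriv c t l ->
  (fun h => c (t + h)) @ (0 : R)^' --> c t.
Proof.
rewrite has_deriv_cvg => cl.
rewrite -[X in _ --> X]addr0 -(scale0r l).
apply: (dnbhs0_cvg_eq _
  (tvs_cvgD (cvg_cst (c t)) (tvs_cvgZ cvg_dnbhs0 cl))) => h h0.
by rewrite scalerA mulfV// scale1r addrC subrK.
Qed.

(** Regularity on a whole neighbourhood, because strict differentiability at [x] involves
    derivatives at nearby points. *)
Definition C1_at E F (f : E -> F) (x : E) :=
  exists A : set E, [/\ open A, A x & Ck 1 A f].

Lemma is_dderivP E F (f : E -> F) (x v : E) :
  (exists l, is_dderiv f x v l) -> is_dderiv f x v (dderiv f x v).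
Proof. by move=> [l fl]; rewrite /dderiv; apply: xgetPex; exists l. Qed.

Lemma dderivE E F (f : E -> F) (x v : E) l : hausdorff_space F ->
  is_dderiv f x v l -> dderiv f x v = l.
Proof.
by move=> hF fl; apply: (cvg_unique hF (is_dderivP _) fl); exists l.
Qed.

Lemma C1_dderiv E F (f : E -> F) (x v : E) :
  C1_at f x -> is_dderiv f x v (dderiv f x v).
Proof. by move=> [A [_ Ax [_ [+ _]]]]; move/(_ _ v Ax)/is_dderivP. Qed.

Lemma is_dderiv_has_deriv E F (f : E -> F) (x v : E) l :
  is_dderiv f x v l <-> has_deriv (fun h => f (x + h *: v)) 0 l.
Proof.
rewrite has_deriv_cvg /is_dderiv.
suff -> : (fun h : R => h^-1 *: (f (x + (0 + h) *: v) - f (x + 0 *: v))) =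
  (fun h : R => h^-1 *: (f (x + h *: v) - f x)) by [].
by apply/funext => h; rewrite add0r scale0r addr0.
Qed.

(** Joint continuity of the derivative keeps [dderiv f (y h + s *: w h) (w h)] in a convex
    neighbourhood of the limit for all small [s]; [mean_value_convex] along the segment does the
    rest. Base point and direction may both move, as the chain rule and additivity require. *)
Lemma C1_strict E F (f : E -> F) (x v : E) (y w : R -> E) : C1_at f x ->
  y @ (0 : R)^' --> x -> w @ (0 : R)^' --> v ->
  (fun h => h^-1 *: (f (y h + h *: w h) - f (y h))) @ (0 : R)^' -->
    dderiv f x v.
Proof.
move=> [A [oA Ax [_ [dfA [cdf _]]]]] yx wv N.
move=> /convex_open_nbhs[B [oB Bx BN cB]].
have s1 : (fun p : R^o * (E * E) => p.2.1) @ nbhs ((0 : R^o), (x, v)) --> x.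
  exact: (cvg_comp _ _ cvg_snd cvg_fst).
have s2 : (fun p : R^o * (E * E) => p.2.2) @ nbhs ((0 : R^o), (x, v)) --> v.
  exact: (cvg_comp _ _ cvg_snd cvg_snd).
have s12 : (fun p : R^o * (E * E) => p.2.1 + p.1 *: p.2.2) @
    nbhs ((0 : R^o), (x, v)) --> x.
  rewrite -[X in _ --> X]addr0 -(scale0r v).
  exact: (tvs_cvgD s1 (tvs_cvgZ cvg_fst s2)).
have cl : (fun p : R^o * (E * E) => (p.2.1 + p.1 *: p.2.2, p.2.2)) @
    nbhs ((0 : R^o), (x, v)) --> ((x, v) : (E * E)%type).
  exact: (cvg_pair s12 s2).
have : \forall p \near ((0 : R^o), (x, v)), A (p.2.1 + p.1 *: p.2.2) /\
    B (dderiv f (p.2.1 + p.1 *: p.2.2) p.2.2).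
  apply: (cl [set q | A q.1 /\ B (dderiv f q.1 q.2)]).
  apply: filterI.
    exists (A, setT) => /=; last by move=> [a b] /= [].
    by split; [exact: open_nbhs_nbhs|exact: filterT].
  by have := cdf (x, v) (conj Ax I) B; apply; exact: open_nbhs_nbhs.
move=> [[/= D K] [/= D0 K0] DK].
have {D0} /nbhs_ballP[e e0 De] := D0.
have : \forall h \near (0 : R)^', K (y h, w h) by exact: (cvg_pair yx wv).
move=> Kh.
suff : \forall h \near (0 : R)^', N (h^-1 *: (f (y h + h *: w h) - f (y h))).
  by [].
near=> h; apply: BN.
have h0 : h != 0 by near: h; exact: nbhs_dnbhs_neq.
have he : `|h| < e by near: h; exact: dnbhs0_lt.
have Kyw : K (y h, w h) by near: h.
have db s : `|s| < e -> exists2 l,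
    has_deriv (fun s => f (y h + s *: w h)) s l & B l.
  move=> se; have /DK/= [As Bs] : (D `*` K) (s, (y h, w h)).
    by split => //; apply: De; rewrite /ball /= sub0r normrN.
  exists (dderiv f (y h + s *: w h) (w h)) => //.
  rewrite has_deriv_shift; under eq_fun do rewrite scalerDl addrA.
  by apply/is_dderiv_has_deriv/is_dderivP; exact: dfA.
(* The mean value theorem wants an increasing interval: for negative [h] it is [[h, 0]], and the two
   sign changes cancel. *)
have [h_lt0|h_gt0|h_eq0] := ltgtP h 0; last by rewrite h_eq0 eqxx in h0.
- have hs s : h <= s <= 0 -> exists2 l,
    has_deriv (fun s => f (y h + s *: w h)) s l & B l.
    move=> /andP[hs s0]; apply: db; rewrite ler0_norm//.
    by rewrite ltr0_norm// in he; lra.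
  have := mean_value_convex h_lt0 oB cB hs.
  by rewrite scale0r addr0 sub0r invrN scaleNr -scalerN opprB.
- have hs s : 0 <= s <= h -> exists2 l,
    has_deriv (fun s => f (y h + s *: w h)) s l & B l.
    move=> /andP[s0 hs]; apply: db; rewrite ger0_norm//.
    by rewrite gtr0_norm// in he; lra.
  have := mean_value_convex h_gt0 oB cB hs.
  by rewrite scale0r addr0 subr0.
Unshelve. all: by end_near. Qed.

(** In [C1_strict] the direction is the difference quotient of [c], so that [c t + h *: w h] is
    exactly [c (t + h)]. *)
Lemma C1_chain E F (f : E -> F) (c : R -> E) t l : C1_at f (c t) ->
  has_deriv c t l -> has_deriv (f \o c) t (dderiv f (c t) l).
Proof.
move=> fc; rewrite !has_deriv_cvg => cl.
apply: (dnbhs0_cvg_eq _ (C1_strict fc (cvg_cst (c t)) cl)) => h h0 /=.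
by rewrite scalerA divff// scale1r [c t + _]addrC subrK.
Qed.

Lemma cvg_line E (x u : E) : (fun h => x + h *: u) @ (0 : R)^' --> x.
Proof.
rewrite -[X in _ --> X]addr0 -(scale0r u).
by apply: tvs_cvgD (cvg_cst _) (tvs_cvgZ cvg_dnbhs0 (cvg_cst _)).
Qed.

(** * Linearity and continuity of the derivative *)

Section Linearity.
Context (E F : tvsType R) (hF : hausdorff_space F) (f : E -> F) (x : E).
Hypothesis fx : C1_at f x.

(** The increment from [x] to [x + h *: (u + v)] passes through [x + h *: u]; the second leg has a
    moving base point, which [C1_strict] allows. *)
Lemma dderivD u v : dderiv f x (u + v) = dderiv f x u + dderiv f x v.
Proof.
apply: (dderivE hF); rewrite /is_dderiv.
apply: (dnbhs0_cvg_eq _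
  (tvs_cvgD (C1_strict fx (cvg_cst x) (cvg_cst u))
            (C1_strict fx (@cvg_line _ x u) (cvg_cst v)))) => h _ /=.
rewrite -scalerDr; congr (_ *: _).
by rewrite scalerDr [x + (_ + _)]addrA [LHS]addrC addrA subrK.
Qed.

Lemma dderiv0 : dderiv f x 0 = 0.
Proof. by apply: (@addrI _ (dderiv f x 0)); rewrite -dderivD !addr0. Qed.

Lemma dderivZ (a : R) v : dderiv f x (a *: v) = a *: dderiv f x v.
Proof.
apply: (dderivE hF); apply/is_dderiv_has_deriv.
(* The substitution of [a * h] for [h] must preserve punctured neighbourhoods of 0, so [a = 0] is
   treated apart. *)
have [->|a0] := eqVneq a 0.
  by rewrite !scale0r; under eq_fun do rewrite scaler0 addr0; exact: has_deriv_cst.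
have am : (fun h : R => a * h) @ (0 : R)^' --> (0 : R)^'.
  move=> N /= [e /= e0 eN]; exists (e / `|a|) => /=.
    by rewrite divr_gt0 ?normr_gt0.
  move=> h /=; rewrite sub0r normrN => he h0; apply: eN.
    by rewrite /= sub0r normrN normrM mulrC -ltr_pdivlMr// normr_gt0.
  by rewrite mulf_neq0.
rewrite has_deriv_cvg.
have := cvg_comp _ _ am (C1_dderiv (v := v) fx).
move=> /(tvs_cvgZ (cvg_cst (a : R^o))) lim.
apply: (dnbhs0_cvg_eq _ lim) => h _ /=.
by rewrite add0r scale0r addr0 invfM !scalerA mulrA divff// mul1r mulrC.
Qed.

Lemma dderiv_continuous : continuous (dderiv f x).
Proof.
case: fx => A [_ Ax [_ [_ [cdf _]]]] v.
apply: (@continuous_comp _ _ _ (fun v => (x, v)) (fun p => dderiv f p.1 p.2)).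
  by apply: cvg_pair; [exact: cvg_cst|exact: cvg_id].
exact: cdf.
Qed.

End Linearity.
End Derivatives.

(** * Velocities in charts *)

Section Charts.
Context (R : realType).
Implicit Types E F : tvsType R.

Lemma Cinfty_C1_at E F (A : set E) (f : E -> F) (x : E) :
  open A -> A x -> Cinfty A f -> C1_at f x.
Proof. by move=> oA Ax /(_ 1%N) fA; exists A. Qed.

(** Read off [Ck 2]; it allows differentiating [Ad], which is itself built from first
    derivatives. *)
Lemma Cinfty_dderiv_C1_at E F (A : set E) (f : E -> F) (x v : E) :
  open A -> A x -> Cinfty A f -> C1_at (fun p => dderiv f p.1 p.2) (x, v).
Proof.
move=> oA Ax /(_ 2%N) [_ [_ fA]]; exists (A `*` setT); split => //.
by rewrite openE => -[y w] [/= Ay _]; exists (A, setT) => //; split => //=;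
  [exact: open_nbhs_nbhs|exact: filterT].
Qed.

Lemma open_preimage_on (S T : topologicalType) (A : set S) (B : set T)
    (f : S -> T) : open A -> open B ->
  (forall x, A x -> {for x, continuous f}) -> open (A `&` f @^-1` B).
Proof.
move=> oA oB cf; rewrite openE => x [Ax Bfx]; apply: filterI.
  exact: open_nbhs_nbhs.
by apply: (cf x Ax); exact: open_nbhs_nbhs.
Qed.

(** The derivative of [f (b + l x)] is the derivative of [f] composed with another affine map,
    [(x, v) |-> (b, 0) + (l x, l v)]. Hence the induction runs over all spaces and all affine
    maps. *)
Lemma Ck_affine E E' F (k : nat) (A : set E) (f : E -> F) (l : E' -> E) (b : E) :
  continuous l -> (forall (a : R) x y, l (a *: x + y) = a *: l x + l y) ->
  Ck k A f -> Ck k [set x | A (b + l x)] (fun x => f (b + l x)).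
Proof.
elim: k => [|k IHk] in E E' A f l b *.
  move=> cl ll [cf _]; split => // x Ax.
  apply: (@continuous_comp _ _ _ (fun x => b + l x) f); last exact: cf.
  by apply: tvs_cvgD; [exact: cvg_cst|exact: cl].
move=> cl ll [cf [df Cdf]].
have dE x v h : f (b + l (x + h *: v)) = f ((b + l x) + h *: l v).
  by congr f; rewrite (addrC x) ll addrCA addrC.
split.
  move=> x Ax.
  apply: (@continuous_comp _ _ _ (fun x => b + l x) f); last exact: cf.
  by apply: tvs_cvgD; [exact: cvg_cst|exact: cl].
split.
  move=> x v /= /(df _ (l v)) [w fw]; exists w.
  by rewrite /is_dderiv; under eq_fun do rewrite dE.
have -> : (fun p : E' * E' => dderiv (fun x => f (b + l x)) p.1 p.2) =
  (fun p => (fun q => dderiv f q.1 q.2) ((b, 0) + (l p.1, l p.2))).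
  (* Both sides choose by [xget] from the same set of limits. *)
  apply/funext => -[x v] /=; rewrite /dderiv; congr (xget 0 _).
  apply/funext => w; rewrite /is_dderiv /= add0r.
  by under eq_fun do rewrite dE.
have := IHk (E * E)%type (E' * E')%type (A `*` setT) (fun q => dderiv f q.1 q.2)
  (fun p => (l p.1, l p.2)) (b, 0).
have -> : [set x : E' | A (b + l x)] `*` setT =
   [set x : E' * E' | (A `*` setT) ((b, 0) + (l x.1, l x.2))] by [].
apply => //.
- move=> [x y]; apply: cvg_pair => /=.
    by apply: (cvg_comp _ _ cvg_fst); exact: cl.
  by apply: (cvg_comp _ _ cvg_snd); exact: cl.
- by move=> a [x1 x2] [y1 y2] /=; rewrite !ll.
Qed.

End Charts.

(** * Velocities of products, inverses and translates of curves *)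

Section Velocities.
Context (R : realType) (E : tvsType R) (G : lieGroupType E).
Local Notation c := (@lie_charts R E G).
Local Notation M := (@lie_manifold R E G).
Implicit Types (x y z : G) (a b : R -> G) (t : R) (u v : E).

Let hE : hausdorff_space E := model_hausdorff M.

Lemma mulg_cont (x y : G) :
  {for (x, y), continuous (fun p : G * G => (p.1 * p.2)%g)}.
Proof. by case: (@mulg_smooth R E G) => + _; exact. Qed.

Lemma invg_cont (x : G) : {for x, continuous (fun y : G => y^-1%g)}.
Proof. by case: (@invg_smooth R E G) => + _; exact. Qed.

(** Unlike [has_velocity], the chart index does not depend on the curve. *)
Definition chart_velocity (x : G) (a : R -> G) (t : R) (v : E) :=
  [/\ {for t, continuous a}, cdom c x (a t) & has_deriv (chart c x \o a) t v].

Local Notation vel := chart_velocity.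

(** Three independent chart indices, so that a product can be read in any chart around it. *)
Definition mulc (x y z : G) : E * E -> E := fun p =>
  chart c z (chart_inv c x p.1 * chart_inv c y p.2)%g.

Definition invc (x y : G) : E -> E := fun p => chart c y ((chart_inv c x p)^-1)%g.

Lemma near_cdom x a t : {for t, continuous a} -> cdom c x (a t) ->
  \forall s \near t, cdom c x (a s).
Proof.
move=> ca xa; apply: ca; apply: open_nbhs_nbhs.
by split => //; exact: cdom_open M x.
Qed.

Lemma open_mulc_dom x y z : open ((ctgt c x `*` ctgt c y) `&`
  [set p | cdom c z (chart_inv c x p.1 * chart_inv c y p.2)%g]).
Proof.
apply: open_preimage_on; last first.
- move=> [p q] [/= xp yq].
  apply: (@continuous_comp _ _ _
     (fun p : E * E => (chart_inv c x p.1, chart_inv c y p.2))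
     (fun p : G * G => (p.1 * p.2)%g)); last exact: mulg_cont.
  apply: cvg_pair => /=.
    by apply: (cvg_comp _ _ cvg_fst); exact: (chart_inv_continuous M xp).
  by apply: (cvg_comp _ _ cvg_snd); exact: (chart_inv_continuous M yq).
- exact: cdom_open M z.
- rewrite openE => -[p q] [/= xp yq].
  exists (ctgt c x, ctgt c y) => //=.
  by split; apply: open_nbhs_nbhs; split => //; exact: ctgt_open M _.
Qed.

Lemma open_invc_dom x y : open (ctgt c x `&`
  [set p | cdom c y (chart_inv c x p)^-1%g]).
Proof.
apply: open_preimage_on; last first.
- move=> p xp; apply: (@continuous_comp _ _ _ (chart_inv c x) (fun p : G => p^-1%g)).
    exact: (chart_inv_continuous M xp).
  exact: invg_cont.
- exact: cdom_open M y.
- exact: ctgt_open M x.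
Qed.

Lemma mulc_smooth x y z : Cinfty ((ctgt c x `*` ctgt c y) `&`
  [set p | cdom c z (chart_inv c x p.1 * chart_inv c y p.2)%g]) (mulc x y z).
Proof.
case: (@mulg_smooth R E G) => _ /(_ (x, y) z).
congr (Cinfty _ _); apply/seteqP; split => p /=; rewrite /setT/=; tauto.
Qed.

Lemma invc_smooth x y : Cinfty (ctgt c x `&`
  [set p | cdom c y (chart_inv c x p)^-1%g]) (invc x y).
Proof.
case: (@invg_smooth R E G) => _ /(_ x y).
congr (Cinfty _ _); apply/seteqP; split => p /=; rewrite /setT/=; tauto.
Qed.

Lemma mulc_dom x y z (a b : G) : cdom c x a -> cdom c y b -> cdom c z (a * b)%g ->
  ((ctgt c x `*` ctgt c y) `&`
  [set p | cdom c z (chart_inv c x p.1 * chart_inv c y p.2)%g])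
   (chart c x a, chart c y b).
Proof.
move=> xa yb zab; split => /=; last by rewrite !(chartK M).
by split; exact: (chart_maps M).
Qed.

Lemma mulc_C1 x y z (a b : G) : cdom c x a -> cdom c y b -> cdom c z (a * b)%g ->
  C1_at (mulc x y z) (chart c x a, chart c y b).
Proof.
move=> xa yb zab; apply: (Cinfty_C1_at _ _ (@mulc_smooth x y z)).
  exact: open_mulc_dom.
exact: mulc_dom.
Qed.

Lemma invc_C1 x y (a : G) : cdom c x a -> cdom c y a^-1%g ->
  C1_at (invc x y) (chart c x a).
Proof.
move=> xa ya; apply: (Cinfty_C1_at _ _ (@invc_smooth x y)).
  exact: open_invc_dom.
by split => /=; [exact: (chart_maps M)|rewrite (chartK M)].
Qed.

(** Near [t] the factors stay in their chart domains, where the product in the chart at [z] is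
    [mulc] of the coordinates; [C1_chain] applies. *)
Lemma vel_mul x y z a b t u v : vel x a t u -> vel y b t v ->
  cdom c z (a t * b t)%g ->
  vel z (fun s => a s * b s)%g t
    (dderiv (mulc x y z) (chart c x (a t), chart c y (b t)) (u, v)).
Proof.
move=> [ca xa da] [cb yb db] zab; split => //.
  apply: (@continuous_comp _ _ _ (fun s => (a s, b s)) (fun p : G * G => (p.1 * p.2)%g)).
    exact: (cvg_pair ca cb).
  exact: mulg_cont.
have := C1_chain (c := fun s => (chart c x (a s), chart c y (b s)))
  (mulc_C1 xa yb zab) (has_deriv_pair da db).
apply: has_deriv_near.
have [xa' yb'] := (near_cdom ca xa, near_cdom cb yb).
near=> s; rewrite /= /mulc /= !(chartK M)//; first by near: s.
by near: s.
Unshelve. all: by end_near. Qed.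

Lemma vel_inv x y a t u : vel x a t u -> cdom c y (a t)^-1%g ->
  vel y (fun s => (a s)^-1%g) t (dderiv (invc x y) (chart c x (a t)) u).
Proof.
move=> [ca xa da] ya; split => //.
  by apply: (@continuous_comp _ _ _ a (fun p : G => p^-1%g)) => //; exact: invg_cont.
have := C1_chain (c := chart c x \o a) (invc_C1 xa ya) da.
apply: has_deriv_near.
have xa' := near_cdom ca xa.
by near=> s; rewrite /= /invc /= (chartK M)//; near: s.
Unshelve. all: by end_near. Qed.

Lemma vel_unique x a t u v : vel x a t u -> vel x a t v -> u = v.
Proof. by move=> [_ _ au] [_ _ av]; apply: has_deriv_unique au av. Qed.

Lemma vel_cst x (p : G) t : cdom c x p -> vel x (fun=> p) t 0.
Proof. by move=> xp; split => //; [exact: cvg_cst|exact: has_deriv_cst]. Qed.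

Lemma vel_shift x a t v : vel x a t v <-> vel x (fun h => a (t + h)) 0 v.
Proof.
have cc : {for (0:R), continuous (fun h => t + h)}.
  exact: (@tvs_cvgD R R^o _ _ _ (fun=> t) id t 0 (cvg_cst _) cvg_id).
have cc' : {for t, continuous (fun h => - t + h)}.
  exact: (@tvs_cvgD R R^o _ _ _ (fun=> - t) id (- t) t (cvg_cst _) cvg_id).
split=> [] [ca xa da]; split.
- by apply: (@continuous_comp _ _ _ _ a) => //; rewrite addr0.
- by rewrite addr0.
- exact/(has_deriv_shift (chart c x \o a)).
- have := @continuous_comp _ _ _ (fun h => - t + h) (fun h => a (t + h)) t cc'.
  rewrite addNr => /(_ ca); congr continuous_at.
  by apply/funext => h /=; rewrite addNKr.
- by rewrite addr0 in xa.
- exact/(has_deriv_shift (chart c x \o a)).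
Qed.

(** Straight in the chart at [x], hence meaningful only for small [t]; it realizes any prescribed
    velocity at [p]. *)
Definition line x (p : G) v : R -> G := fun t => chart_inv c x (chart c x p + t *: v).

Lemma line0 x (p : G) v : cdom c x p -> line x p v 0 = p.
Proof. by move=> xp; rewrite /line scale0r addr0 (chartK M). Qed.

Lemma vel_line x (p : G) v : cdom c x p -> vel x (line x p v) 0 v.
Proof.
move=> xp; have tp := chart_maps M xp.
have cl : {for (0:R), continuous (fun t : R => chart c x p + t *: v)}.
  apply: tvs_cvgD; first exact: cvg_cst.
  by apply: (@tvs_cvgZ R E _ _ _ id); [exact: cvg_id|exact: cvg_cst].
have e0 : chart c x p + 0 *: v = chart c x p by rewrite scale0r addr0.
split; last first.
- have := has_deriv_line (chart c x p) (v := v) 0; apply: has_deriv_near.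
  have : \forall t \near (0 : R), ctgt c x (chart c x p + t *: v).
    by apply: cl; rewrite e0; apply: open_nbhs_nbhs; split => //; exact: ctgt_open M x.
  by move=> tn; near=> t; rewrite /= (chart_invK M)//; near: t.
- by rewrite line0.
- rewrite /line; apply: (@continuous_comp _ _ _ (fun t : R => chart c x p + t *: v)
    (chart_inv c x)) => //.
  by rewrite e0; exact: (chart_inv_continuous M tp).
Unshelve. all: by end_near. Qed.

(** Left translation is multiplication with the first factor frozen; its tangent map thus inherits
    linearity and continuity from the derivative of [mulc]. *)
Lemma tangent_ltransE (s p : G) v : @tangent_map R E E G G c c (ltrans s) p v =
  dderiv (mulc s p (s * p)%g) (chart c s s, chart c p p) (0, v).
Proof.
apply: (dderivE hE).
have := @C1_dderiv _ _ _ (mulc s p (s * p)%g) (chart c s s, chart c p p) (0, v).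
move=> /(_ (mulc_C1 _ _ _)); rewrite /is_dderiv => H.
move: (H (cdom_mem M _) (cdom_mem M _) (cdom_mem M _)).
suff -> : (fun h : R => h^-1 *:
    (mulc s p (s * p)%g ((chart c s s, chart c p p) + h *: (0, v)) -
     mulc s p (s * p)%g (chart c s s, chart c p p))) =
   (fun h => h^-1 *: ((chart c (ltrans s p) \o ltrans s \o chart_inv c p)
      (chart c p p + h *: v) -
    (chart c (ltrans s p) \o ltrans s \o chart_inv c p) (chart c p p))) by [].
apply/funext => h; rewrite /mulc /ltrans /= scaler0 addr0 !(chartK M)//; exact: (cdom_mem M).
Qed.

Lemma tangent_rtransE (s p : G) v : @tangent_map R E E G G c c (rtrans s) p v =
  dderiv (mulc p s (p * s)%g) (chart c p p, chart c s s) (v, 0).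
Proof.
apply: (dderivE hE).
have := @C1_dderiv _ _ _ (mulc p s (p * s)%g) (chart c p p, chart c s s) (v, 0).
move=> /(_ (mulc_C1 _ _ _)); rewrite /is_dderiv => H.
move: (H (cdom_mem M _) (cdom_mem M _) (cdom_mem M _)).
suff -> : (fun h : R => h^-1 *:
    (mulc p s (p * s)%g ((chart c p p, chart c s s) + h *: (v, 0)) -
     mulc p s (p * s)%g (chart c p p, chart c s s))) =
   (fun h => h^-1 *: ((chart c (rtrans s p) \o rtrans s \o chart_inv c p)
      (chart c p p + h *: v) -
    (chart c (rtrans s p) \o rtrans s \o chart_inv c p) (chart c p p))) by [].
apply/funext => h; rewrite /mulc /rtrans /= scaler0 addr0 !(chartK M)//; exact: (cdom_mem M).
Qed.

Lemma vel_ltrans (s p : G) b t v : vel p b t v -> b t = p ->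
  vel (s * p)%g (fun r => s * b r)%g t (@tangent_map R E E G G c c (ltrans s) p v).
Proof.
move=> bv bp; rewrite tangent_ltransE.
have := @vel_mul _ _ (s * p)%g _ _ _ _ _ (vel_cst t (cdom_mem M s)) bv.
by rewrite bp; apply; exact: (cdom_mem M).
Qed.

Lemma vel_rtrans (s p : G) b t v : vel p b t v -> b t = p ->
  vel (p * s)%g (fun r => b r * s)%g t (@tangent_map R E E G G c c (rtrans s) p v).
Proof.
move=> bv bp; rewrite tangent_rtransE.
have := @vel_mul _ _ (p * s)%g _ _ _ _ _ bv (vel_cst t (cdom_mem M s)).
by rewrite bp; apply; exact: (cdom_mem M).
Qed.

(** [Ad] as the derivative of conjugation. With [vel_unique], identities between curves in the group
    become identities for [Ad]. *)
Lemma vel_Ad (s : G) b t v : vel 1%g b t v -> b t = 1%g ->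
  vel 1%g (fun r => s * b r * s^-1)%g t (Ad s v).
Proof.
move=> bv b1.
have := vel_ltrans s bv b1; rewrite mulg1 => sb.
have := vel_rtrans s^-1%g sb; rewrite b1 mulg1 mulgV; exact.
Qed.

End Velocities.

(** * The adjoint representation *)

Lemma has_deriv_linear (R : realType) (E F : tvsType R) (f : E -> F) (v : R -> E)
    (t : R) (l : E) : continuous f ->
    (forall (a : R) x y, f (a *: x + y) = a *: f x + f y) ->
  has_deriv v t l -> has_deriv (f \o v) t (f l).
Proof.
move=> cf lf; rewrite !has_deriv_cvg => vl.
have fB x y : f (x - y) = f x - f y.
  by rewrite addrC -scaleN1r lf scaleN1r addrC.
have f0 : f 0 = 0 by rewrite -(subrr 0) fB subrr.
have fZ (a : R) x : f (a *: x) = a *: f x by rewrite -[a *: x]addr0 lf f0 addr0.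
apply: (dnbhs0_cvg_eq _ (cvg_comp _ _ vl (cf l))) => h _ /=.
by rewrite fZ fB.
Qed.

Section Adjoint.
Context (R : realType) (E : tvsType R) (G : lieGroupType E).
Local Notation c := (@lie_charts R E G).
Local Notation M := (@lie_manifold R E G).
Local Notation vel := (@chart_velocity R E G).
Implicit Types (u v w : E).

Let hE : hausdorff_space E := model_hausdorff M.
Let dom := cdom_mem M.

Lemma exists_vel1 v : exists2 b : R -> G, vel 1%g b 0 v & b 0 = 1%g.
Proof.
exists (line 1%g 1%g v); first by apply: vel_line; exact: dom.
by apply: line0; exact: dom.
Qed.

Lemma AdM (s r : G) v : Ad (s * r)%g v = Ad s (Ad r v).
Proof.
have [b bv b1] := exists_vel1 v.
apply: vel_unique (vel_Ad (s * r)%g bv b1) _.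
have rb1 : (r * b 0 * r^-1)%g = 1%g by rewrite b1 mulg1 mulgV.
have := vel_Ad s (vel_Ad r bv b1) rb1.
congr (chart_velocity _ _ _ _); apply/funext => t.
by rewrite invgM !mulgA.
Qed.

Lemma Ad1 v : Ad (1%g : G) v = v.
Proof.
have [b bv b1] := exists_vel1 v.
apply: vel_unique (vel_Ad 1%g bv b1) _.
by under eq_fun do rewrite mul1g invg1 mulg1.
Qed.

Lemma AdK (s : G) v : Ad s^-1%g (Ad s v) = v.
Proof. by rewrite -AdM mulVg Ad1. Qed.

Lemma AdVK (s : G) v : Ad s (Ad s^-1%g v) = v.
Proof. by rewrite -AdM mulgV Ad1. Qed.

Lemma Ad_linear (s : G) (a : R) u v : Ad s (a *: u + v : E) = a *: Ad s u + Ad s v :> E.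
Proof.
rewrite /Ad !tangent_ltransE !tangent_rtransE.
have C1l := mulc_C1 (dom s) (dom 1%g) (dom (s * 1)%g).
have C1r := mulc_C1 (dom s) (dom s^-1%g) (dom (s * s^-1)%g).
have -> : (0, a *: u + v) = a *: ((0, u) : (E * E)%type) + ((0, v) : (E * E)%type).
  by congr (_, _); rewrite /= ?scaler0 ?addr0.
rewrite dderivD// dderivZ//.
set L := dderiv (mulc s 1%g _) _; set x := L (0, u); set y := L (0, v).
have -> : (a *: x + y, 0) = a *: ((x, 0) : (E * E)%type) + ((y, 0) : (E * E)%type).
  by congr (_, _); rewrite /= ?scaler0 ?addr0.
by rewrite dderivD// dderivZ.
Qed.

Lemma Ad_continuous (s : G) : continuous (Ad s : E -> E).
Proof.
move=> v.
have -> : (Ad s : E -> E) = (fun w => dderiv (mulc s s^-1%g (s * s^-1)%g)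
    (chart c s s, chart c s^-1%g s^-1%g) (w, 0)) \o
  (fun w => dderiv (mulc s 1%g (s * 1)%g) (chart c s s, chart c 1%g 1%g) (0, w)).
  by apply/funext => w; rewrite /Ad tangent_rtransE tangent_ltransE.
apply: continuous_comp.
  apply: (@continuous_comp _ _ _ (fun w : E => ((0, w) : (E * E)%type))
    (dderiv (mulc s 1%g (s * 1)%g) (chart c s s, chart c 1%g 1%g))).
    by apply: cvg_pair; [exact: cvg_cst|exact: cvg_id].
  by apply: dderiv_continuous; apply: mulc_C1.
apply: (@continuous_comp _ _ _ (fun w : E => ((w, 0) : (E * E)%type))
    (dderiv (mulc s s^-1%g (s * s^-1)%g) (chart c s s, chart c s^-1%g s^-1%g))).
  by apply: cvg_pair; [exact: cvg_id|exact: cvg_cst].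
by apply: dderiv_continuous; apply: mulc_C1.
Qed.

Lemma has_deriv_Ad (s : G) (v : R -> E) t l :
  has_deriv v t l -> has_deriv (fun r => Ad s (v r) : E) t (Ad s l).
Proof.
move=> vl; apply: (has_deriv_linear (f := Ad s : E -> E)) => //.
- exact: Ad_continuous.
- by move=> *; exact: Ad_linear.
Qed.

Local Notation m := (mulc (1 : G)%g 1%g 1%g).
Local Notation dm := (fun q : (E * E) * (E * E) => dderiv m q.1 q.2).
Local Notation e := (chart c 1%g 1%g).

(** The definition of [Ad] uses the preferred chart at [s], which need not vary continuously with
    [s]. Here every chart is the one at 1, so the formula can be differentiated in [s]. *)
Lemma Ad_near1 (s : G) v : cdom c 1%g s -> cdom c 1%g s^-1%g ->
  Ad s v = dderiv m (chart c 1%g s, chart c 1%g s^-1%g)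
    (dderiv m (chart c 1%g s, e) (0, v), 0).
Proof.
move=> ds dsV; have [b bv b1] := exists_vel1 v.
apply: vel_unique (vel_Ad s bv b1) _.
have := @vel_mul _ _ _ _ _ 1%g _ _ _ _ _ (vel_cst 0 ds) bv.
rewrite b1 mulg1 => /(_ ds) sb.
have := @vel_mul _ _ _ _ _ 1%g _ _ _ _ _ sb (vel_cst 0 dsV).
by rewrite /= b1 mulg1 mulgV; apply; exact: dom.
Qed.

(** The derivative of [Ad (a t) (v t)] at [a 0 = 1], read off [Ad_near1];
    [u] and [w] are the velocities of [a] and [v]. *)
Definition Ad_deriv v u w : E :=
  dderiv dm ((e, e), (dderiv m (e, e) (0, v), 0))
    ((u, dderiv (invc 1%g (1 : G)%g) e u),
     (dderiv dm ((e, e), (0, v)) ((u, 0), (0, w)), 0)).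

Lemma dm_C1 (p : E * E) : C1_at dm ((e, e), p).
Proof.
apply: Cinfty_dderiv_C1_at (@mulc_smooth R E G 1%g 1%g 1%g).
  exact: open_mulc_dom.
by apply: mulc_dom; rewrite ?mulg1; exact: dom.
Qed.

(** Each [dderiv] in [Ad_deriv] is taken at a base point depending on [v] alone, and is additive in
    its direction. *)
Lemma Ad_derivD v u1 u2 w1 w2 :
  Ad_deriv v (u1 + u2) (w1 + w2) = Ad_deriv v u1 w1 + Ad_deriv v u2 w2.
Proof.
rewrite /Ad_deriv dderivD//; last first.
  by apply: invc_C1; rewrite ?invg1; exact: dom.
have -> : ((u1 + u2, 0), (0, w1 + w2)) =
    (((u1, 0), (0, w1)) : (E * E) * (E * E))%type + ((u2, 0), (0, w2)).
  by congr ((_, _), (_, _)); rewrite /= addr0.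
rewrite (dderivD hE (dm_C1 (0, v))).
apply: (etrans _ (dderivD hE (dm_C1 (dderiv m (e, e) (0, v), 0)) _ _)).
congr (dderiv _ _ _); congr ((_, _), (_, _)); rewrite /= ?addr0//.
Qed.

Lemma has_deriv_Ad_deriv (a : R -> G) (v : R -> E) u w :
  vel 1%g a 0 u -> a 0 = 1%g -> has_deriv v 0 w ->
  has_deriv (fun t => Ad (a t) (v t) : E) 0 (Ad_deriv (v 0) u w).
Proof.
move=> au a1 vw.
have aV := @vel_inv _ _ _ _ 1%g _ _ _ au.
rewrite a1 invg1 in aV; have {aV}[caV _ daV] := aV (dom _).
have [ca _ da] := au.
have d1 := has_deriv_pair (has_deriv_pair da (has_deriv_cst e 0))
  (has_deriv_pair (has_deriv_cst (0 : E) 0) vw).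
have C1 := dm_C1 (0, v 0).
(* [d2] differentiates the inner layer of [Ad_near1], the left translation; [d4] differentiates the
   outer one. *)
have d2 := C1_chain (f := dm) (c := fun t => ((chart c 1%g (a t), e), (0, v t)))
  _ d1.
rewrite /= a1 in d2; move: d2 => /(_ C1) d2.
have d3 := has_deriv_pair (has_deriv_pair da daV)
  (has_deriv_pair d2 (has_deriv_cst (0 : E) 0)).
have d4 := C1_chain (f := dm) (c := fun t => ((chart c 1%g (a t), chart c 1%g (a t)^-1%g),
    (dderiv m (chart c 1%g (a t), e) (0, v t), 0))) _ d3.
rewrite /= a1 invg1 in d4; move: d4 => /(_ (dm_C1 _)).
apply: has_deriv_near.
have na : \forall t \near (0 : R), cdom c 1%g (a t).
  by apply: near_cdom ca _; rewrite a1; exact: dom.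
have naV : \forall t \near (0 : R), cdom c 1%g (a t)^-1%g.
  by apply: near_cdom caV _; rewrite a1 invg1; exact: dom.
by near=> t; rewrite /= -Ad_near1//; near: t.
Unshelve. all: by end_near. Qed.

(** [ad] is specified by smooth curves only; one such curve with velocity [u] must exist for its
    value to be determined. *)
Lemma line_smooth u : smooth_curve_near (line (1 : G)%g 1%g u) 0.
Proof.
pose l := fun t : R^o => t *: u.
have cl : continuous l.
  by move=> t; apply: (@tvs_cvgZ R E _ _ _ id); [exact: cvg_id|exact: cvg_cst].
have cel : continuous (fun t => e + l t).
  by move=> t; apply: tvs_cvgD; [exact: cvg_cst|exact: cl].
exists [set t : R^o | ctgt c 1%g (e + l t)].
  split; last by rewrite /= /l scale0r addr0; apply: (chart_maps M); exact: dom.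
  rewrite openE => t tt; apply: cel; apply: open_nbhs_nbhs; split => //.
  exact: (ctgt_open M).
split.
  move=> t tt; apply: (@continuous_comp _ _ _ (fun t => e + l t) (chart_inv c 1%g)).
    exact: cel.
  exact: (chart_inv_continuous M tt).
move=> x y k.
have ll (a : R) (x0 y0 : R^o) : l (a *: x0 + y0) = a *: l x0 + l y0.
  by rewrite /l scalerDl scalerA.
(* In the chart at [y] the line is a transition map composed with an affine map. *)
have := Ck_affine e cl ll (transition_smooth M 1%g y k).
congr (Ck _ _ _).
by apply/seteqP; split => t /=; rewrite /setT /=; tauto.
Qed.

(** [Ad_deriv v u 0] meets the condition in the definition of [ad], so [xget] does not fall back on
    0, and testing on [line] shows that it is the chosen value. The formula then extends to curves
    merely differentiable at 0. *)
Lemma ad_spec u v (a : R -> G) : vel 1%g a 0 u -> a 0 = 1%g ->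
  has_deriv (fun t => Ad (a t) v : E) 0 (ad (u : lie_algebra G) v).
Proof.
move=> au a1.
pose P := [set w : lie_algebra G | forall s : R -> G, smooth_curve_near s 0 -> s 0 = 1%g ->
                    @has_velocity R E G c s 0 u ->
                    has_deriv (fun t => Ad (s t) v) 0 w].
have Pd : P (Ad_deriv v u 0).
  move=> s _ s1 [cs ds]; apply: (has_deriv_Ad_deriv (v := fun=> v)) => //.
    by split => //; rewrite s1 in ds *; [exact: dom|].
  exact: has_deriv_cst.
have Pad : P (ad (u : lie_algebra G) v) by apply: xgetPex; exists (Ad_deriv v u 0).
have [cl _ dl] := vel_line u (dom (1 : G)%g).
have l0 := line0 u (dom (1 : G)%g).
have hl : @has_velocity R E G c (line 1%g 1%g u) 0 u by split => //; rewrite l0.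
have -> : ad (u : lie_algebra G) v = Ad_deriv v u 0.
  apply: (has_deriv_unique hE (Pad _ (line_smooth u) l0 hl)).
  exact: (Pd _ (line_smooth u) l0 hl).
by apply: (has_deriv_Ad_deriv (v := fun=> v)) => //; exact: has_deriv_cst.
Qed.

Lemma adE u v : ad (u : lie_algebra G) v = Ad_deriv v u 0.
Proof.
have [b bv b1] := exists_vel1 u.
apply: (has_deriv_unique hE (ad_spec (v := v) bv b1)).
by apply: (has_deriv_Ad_deriv (v := fun=> v)) => //; exact: has_deriv_cst.
Qed.

Lemma has_deriv_Ad_curve (a : R -> G) (v : R -> E) u w :
  vel 1%g a 0 u -> a 0 = 1%g -> has_deriv v 0 w ->
  has_deriv (fun t => Ad (a t) (v t) : E) 0 (ad (u : lie_algebra G) (v 0) + w).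
Proof.
move=> au a1 vw; have := has_deriv_Ad_deriv au a1 vw.
rewrite -[u]addr0 -[w in Ad_deriv _ _ w]add0r Ad_derivD -adE addr0.
(* Along the constant curve 1, [Ad] is the identity, so this term is the derivative of [v]
   itself. *)
suff -> : Ad_deriv (v 0) 0 w = w by [].
have v1 : vel 1%g (fun=> 1%g) 0 0 by apply: vel_cst; exact: dom.
apply: (has_deriv_unique hE (has_deriv_Ad_deriv v1 erefl vw)).
by under eq_fun do rewrite Ad1.
Qed.

Lemma adDl u1 u2 v : ad (u1 + u2 : lie_algebra G) v =
  ad (u1 : lie_algebra G) v + ad (u2 : lie_algebra G) v.
Proof. by rewrite !adE -Ad_derivD addr0. Qed.

(** Differentiate [Ad s (Ad (b t) v) = Ad (s * b t * s^-1) (Ad s v)] at [t = 0]. *)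
Lemma Ad_ad (s : G) u v :
  Ad s (ad (u : lie_algebra G) v) = ad (Ad s u) (Ad s v).
Proof.
have [b bv b1] := exists_vel1 u.
have sb1 : (s * b 0 * s^-1)%g = 1%g by rewrite b1 mulg1 mulgV.
apply: (has_deriv_unique hE (has_deriv_Ad (s := s) (ad_spec (v := v) bv b1))).
have := ad_spec (v := Ad s v) (vel_Ad s bv b1) sb1.
by under eq_fun do rewrite !AdM AdK.
Qed.

End Adjoint.

(** * Flows of right-invariant vector fields *)

(** By the mean value theorem a difference quotient lies in every convex open neighbourhood of 0; in
    a Hausdorff space it is then 0. *)
Lemma has_deriv0_constant (R : realType) (F : tvsType R) (J : set R) (a : R -> F)
    (s t : R) : hausdorff_space F -> is_interval J ->
  (forall r, J r -> has_deriv a r 0) -> J s -> J t -> a s = a t.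
Proof.
move=> hF iJ da.
wlog st : s t / s <= t.
  move=> H Js Jt; have [st|/ltW ts] := leP s t; first exact: H.
  by apply/esym/H.
move: st; rewrite le_eqVlt => /predU1P[->//|st] Js Jt.
apply/esym/eqP; rewrite -subr_eq0.
have -> : a t - a s = (t - s) *: ((t - s)^-1 *: (a t - a s)).
  by rewrite scalerA divff ?scale1r// subr_eq0 gt_eqF.
suff <- : 0 = (t - s)^-1 *: (a t - a s) by rewrite scaler0.
apply: hF => A B A0 Bq.
exists ((t - s)^-1 *: (a t - a s)); split; last exact: nbhs_singleton.
have [C [oC C0 CA cC]] := convex_open_nbhs A0.
apply: CA; apply: (mean_value_convex st oC cC) => r /andP[sr rt].
by exists 0 => //; apply: da; apply: (iJ s t) => //; rewrite sr rt.
Qed.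

Section Flow.
Context (R : realType) (E : tvsType R) (G : lieGroupType E).
Local Notation c := (@lie_charts R E G).
Local Notation M := (@lie_manifold R E G).
Local Notation vel := (@chart_velocity R E G).
Implicit Types (u v w : E).

Let hE : hausdorff_space E := model_hausdorff M.
Let dom := cdom_mem M.

Lemma vel_mul0 (x y z : G) (a b : R -> G) t : vel x a t 0 -> vel y b t 0 ->
  cdom c z (a t * b t)%g -> vel z (fun s => a s * b s)%g t 0.
Proof.
move=> a0 b0 zab; have := vel_mul a0 b0 zab.
suff -> : dderiv (mulc x y z) (chart c x (a t), chart c y (b t)) (0, 0) = 0 by [].
have [[_ xa _] [_ yb _]] := (a0, b0).
exact: (dderiv0 hE (mulc_C1 xa yb zab)).
Qed.

(** The velocity depends only on the positions and velocities of the factors at [t], so it is that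
    of [(a s)^-1 * a s], which is constant. *)
Lemma vel_mulVg0 (a b : R -> G) t u : vel 1%g a t u -> vel 1%g b t u ->
  a t = 1%g -> b t = 1%g -> vel 1%g (fun s => (a s)^-1 * b s)%g t 0.
Proof.
move=> au bu a1 b1.
have aV := @vel_inv _ _ _ _ 1%g _ _ _ au; rewrite a1 invg1 in aV.
have {}aV := aV (dom _).
have := @vel_mul _ _ _ _ _ 1%g _ _ _ _ _ aV bu.
rewrite a1 b1 invg1 mulg1 => /(_ (dom _)).
have := @vel_mul _ _ _ _ _ 1%g _ _ _ _ _ aV au.
rewrite a1 invg1 mulg1 => /(_ (dom _)).
under eq_fun do rewrite mulVg.
by move=> /vel_unique /(_ (vel_cst t (dom _))) ->.
Qed.

Context (X : E) (J : set R) (gamma : R -> G).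
Hypothesis oJ : open_interval J.
Hypothesis J0 : J 0.
Hypothesis flowX : is_flow (X : lie_algebra G) J gamma.

(** At time [t] the flow has the velocity of [b r * gamma t], where [b] starts at 1 with velocity
    [X]; translating both curves back by [(gamma t)^-1] leaves [X]. *)
Lemma flow_increment t : J t ->
  vel 1%g (fun h => gamma (t + h) * (gamma t)^-1)%g 0 X.
Proof.
move=> Jt; have [_ /(_ _ Jt)[cg dg]] := flowX.
have : vel (gamma t) gamma t
    (@tangent_map R E E G G c c (rtrans (gamma t)) 1%g X) by [].
move=> /vel_shift /(vel_rtrans (gamma t)^-1%g).
rewrite addr0 => /(_ erefl) gt.
have [b bX b1] := exists_vel1 G X.
have := vel_rtrans (gamma t) bX b1; rewrite mul1g => /(vel_rtrans (gamma t)^-1%g).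
rewrite b1 mul1g => /(_ erefl) bt.
rewrite mulgV in gt bt.
have bt' : vel 1%g (fun r => b r * gamma t * (gamma t)^-1)%g 0 X.
  by under eq_fun do rewrite mulgK.
by rewrite (vel_unique bt' bt).
Qed.

Lemma flow_velocity0 : vel 1%g gamma 0 X.
Proof.
have := flow_increment J0; have [-> _] := flowX.
by under eq_fun do rewrite add0r invg1 mulg1.
Qed.

(** Small times keep [delta] in the chart at 1, where zero velocity means constant coordinates; its
    value at 0 is [gamma t]. *)
Lemma flow_local_morphism : exists2 d : R, 0 < d &
  forall s t, `|s| < d -> `|t| < d -> gamma (s + t) = (gamma s * gamma t)%g.
Proof.
have [g0 _] := flowX.
have [cg _ _] := flow_velocity0.
have ch : {for ((1%g : G), (1%g : G)), continuous (fun p : G * G => (p.1^-1 * p.2)%g)}.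
  apply: (@continuous_comp _ _ _ (fun p : G * G => (p.1^-1%g, p.2))
    (fun p : G * G => (p.1 * p.2)%g)).
    apply: cvg_pair; last exact: cvg_snd.
    by apply: (cvg_comp _ _ cvg_fst); exact: invg_cont.
  exact: mulg_cont.
have [[W1 W2] [/= W11 W21] W12] : nbhs ((1%g : G), (1%g : G))
    [set p : G * G | cdom c 1%g (p.1^-1 * p.2)%g].
  apply: ch; rewrite /= invg1 mulg1; apply: open_nbhs_nbhs.
  by split; [exact: cdom_open M _|exact: dom].
have : nbhs (0 : R) (J `&` gamma @^-1` (W1 `&` W2)).
  apply: filterI; first by apply: open_nbhs_nbhs; split => //; case: oJ.
  by apply: cg; rewrite g0; exact: filterI.
move=> /nbhs_ballP[d /= d0 Hd].
have {}Hd r : `|r| < d -> [/\ J r, W1 (gamma r) & W2 (gamma r)].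
  move=> rd; have [|? []//] := Hd r.
  by rewrite /ball /= sub0r normrN.
(* Half of [d], so that [r + t] stays within [d] of 0. *)
exists (d / 2); first by rewrite divr_gt0.
move=> s t sd td.
pose I := [set r : R | `|r| < d / 2].
have Id r : I r -> `|r| < d by move=> /lt_trans; apply; lra.
have Itd r : I r -> `|r + t| < d.
  by move=> Ir; apply: (le_lt_trans (ler_normD _ _)); rewrite /I /= in Ir; lra.
pose delta r := ((gamma r)^-1 * gamma (r + t))%g.
have ddelta r : I r -> cdom c 1%g (delta r).
  by move=> Ir; apply: (W12 (gamma r, gamma (r + t))); split;
    [case: (Hd _ (Id _ Ir))|case: (Hd _ (Itd _ Ir))].
(* [delta (r + h)] is the product of the two increments, the first inverted, placed between the
   constants [(gamma r)^-1] and [gamma (r + t)]; [vel_mulVg0] applies to the middle. *)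
have vdelta r : I r -> vel 1%g delta r 0.
  move=> Ir; apply/vel_shift.
  have [Jr _ _] := Hd _ (Id _ Ir); have [Jrt _ _] := Hd _ (Itd _ Ir).
  have := vel_mulVg0 (flow_increment Jr) (flow_increment Jrt).
  rewrite !addr0 !mulgV => /(_ erefl erefl) v0.
  have := @vel_mul0 _ _ (gamma (r + t)) _ _ _ v0 (vel_cst 0 (dom (gamma (r + t)))).
  rewrite !addr0 !mulgV invg1 !mul1g => /(_ (dom _)) v1.
  have := @vel_mul0 _ _ 1%g _ _ _ (vel_cst 0 (dom (gamma r)^-1%g)) v1.
  rewrite !addr0 !mulgV invg1 !mul1g => /(_ (ddelta _ Ir)).
  congr (chart_velocity _ _ _ _); apply/funext => h.
  by rewrite /delta invgM invgK !mulgA mulVg mul1g mulgVK addrAC.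
have iI : is_interval I.
  move=> x y xI yI z /andP[xz zy].
  by move: xI yI; rewrite /I /= !ltr_norml => /andP[? ?] /andP[? ?]; lra.
have I0 : I 0 by rewrite /I /= normr0 divr_gt0.
have dd r : I r -> has_deriv (chart c 1%g \o delta) r 0 by move=> /vdelta[].
have /= e := has_deriv0_constant hE iI dd sd I0.
have : delta s = delta 0.
  rewrite -[LHS](chartK M (ddelta _ sd)) -[RHS](chartK M (ddelta _ I0)).
  by congr chart_inv.
rewrite /delta add0r g0 invg1 mul1g => <-.
by rewrite mulVKg.
Qed.

(** For small times [gamma s] and [gamma t] commute, so conjugation by [gamma s] fixes the flow and
    [Ad (gamma s) X = X]; differentiate at [s = 0]. *)
Lemma ad_self : ad (X : lie_algebra G) X = 0.
Proof.
have [d d0 morph] := flow_local_morphism.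
have [g0 _] := flowX.
have near0 : \forall s \near (0 : R), `|s| < d.
  by apply/nbhs_ballP; exists d => // s; rewrite /ball /= sub0r normrN.
have AdX s : `|s| < d -> Ad (gamma s) X = X.
  move=> sd.
  have [_ _ Xs] := vel_Ad (gamma s) flow_velocity0 g0.
  have [_ _ X0] := flow_velocity0.
  apply: (has_deriv_unique hE Xs); apply: has_deriv_near X0.
  near=> t; rewrite /=; congr (chart _ _ _).
  have td : `|t| < d by near: t.
  by rewrite -morph// addrC morph// mulgK.
apply: (has_deriv_unique hE (ad_spec (v := X) flow_velocity0 g0)).
apply: has_deriv_near (has_deriv_cst X 0).
by near=> s; rewrite AdX//; near: s.
Unshelve. all: by end_near. Qed.

Lemma has_deriv_Ad_flow (v : R -> E) t w : J t -> has_deriv v t w ->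
  has_deriv (fun s => Ad (gamma s) (v s) : E) t
    (ad (X : lie_algebra G) (Ad (gamma t) (v t)) + Ad (gamma t) w).
Proof.
move=> Jt /has_deriv_shift /(has_deriv_Ad (s := gamma t)) vw.
have g1 : (gamma (t + 0) * (gamma t)^-1)%g = 1%g by rewrite addr0 mulgV.
apply/has_deriv_shift.
have := has_deriv_Ad_curve (flow_increment Jt) g1 vw.
rewrite addr0; apply: has_deriv_near; near=> h.
by rewrite -AdM mulgVK.
Unshelve. all: by end_near. Qed.

Lemma has_deriv_Ad_flow_cst v t : J t ->
  has_deriv (fun s => Ad (gamma s) v : E) t
    (ad (X : lie_algebra G) (Ad (gamma t) v)).
Proof.
move=> Jt; have := has_deriv_Ad_flow Jt (has_deriv_cst v t).
suff -> : Ad (gamma t) 0 = 0 :> E by rewrite addr0.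
by have := Ad_linear (gamma t) (- 1) 0 0; rewrite scaler0 addr0 scaleN1r addNr.
Qed.

(** An equation for [U] gives differentiability of [U] only; this transfers it to [V] by the product
    rule along the inverted increment. The forward rule later identifies the derivative. *)
Lemma has_deriv_Ad_flowV (v : R -> E) t l : J t ->
  has_deriv (fun s => Ad (gamma s) (v s) : E) t l -> exists w, has_deriv v t w.
Proof.
move=> Jt /has_deriv_shift W.
have g1 : (gamma (t + 0) * (gamma t)^-1)%g = 1%g by rewrite addr0 mulgV.
have sV := @vel_inv _ _ _ _ 1%g _ _ _ (flow_increment Jt).
rewrite g1 invg1 in sV; move: sV => /(_ (dom _)) sV.
have gV1 : (gamma (t + 0) * (gamma t)^-1)^-1%g = 1%g by rewrite g1 invg1.
have := has_deriv_Ad (s := (gamma t)^-1%g) (has_deriv_Ad_curve sV gV1 W).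
set w := Ad _ (_ + _) => dw; exists w; apply/has_deriv_shift.
apply: has_deriv_near dw; near=> h.
(* The three group elements acting on [v (t + h)] multiply to 1. *)
by rewrite -!AdM invgM invgK mulKg mulVg Ad1.
Unshelve. all: by end_near. Qed.

End Flow.

(** * The inner product *)

(* Keeps unification from unfolding these into limits when it compares
   [ip _ (ad _ _)] with [ip _ (Ad _ _)]. *)
#[local] Opaque Ad ad.

Section InnerProduct.
Context (R : realType) (E : tvsType R) (G : lieGroupType E).
Local Notation g := (lie_algebra G).
Context (ip : g -> g -> R).
Hypothesis ipP : inner_product ip.
Implicit Types (u v w : g).

Lemma ipDl u v w : ip (u + v) w = ip u w + ip v w.
Proof. by rewrite -[u]scale1r (ip_linear ipP) mul1r scale1r. Qed.

Lemma ip0l w : ip 0 w = 0.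
Proof. by apply: (@addrI _ (ip 0 w)); rewrite -ipDl !addr0. Qed.

Lemma ipZl (a : R) u w : ip (a *: u) w = a * ip u w.
Proof. by rewrite -[a *: u]addr0 (ip_linear ipP) ip0l addr0. Qed.

Lemma ipNl u w : ip (- u) w = - ip u w.
Proof. by rewrite -scaleN1r ipZl mulN1r. Qed.

Lemma ipDr u v w : ip w (u + v) = ip w u + ip w v.
Proof. by rewrite !(ip_sym ipP w) ipDl. Qed.

Lemma ipNr u w : ip w (- u) = - ip w u.
Proof. by rewrite !(ip_sym ipP w) ipNl. Qed.

Lemma ipZr (a : R) u w : ip w (a *: u) = a * ip w u.
Proof. by rewrite !(ip_sym ipP w) ipZl. Qed.

(** [coad] is known only through its pairing, so identities for it are tested against all [w]. *)
Lemma ip_inj u v : (forall w, ip u w = ip v w) -> u = v.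
Proof.
move=> uv; apply/eqP; rewrite -subr_eq0; apply/negPn/negP => /(ip_pos ipP).
by rewrite ipDl ipNl uv subrr ltxx.
Qed.

(** The usual splitting of the increment, the first term carrying [b (t + h)]; joint continuity of
    [ip] passes to the limit. *)
Lemma has_deriv_ip (a b : R -> g) t u v : has_deriv a t u -> has_deriv b t v ->
  has_deriv (fun s => ip (a s) (b s) : R^o) t (ip u (b t) + ip (a t) v).
Proof.
move=> da db; have := has_deriv_cvg0 db.
move: da db; rewrite !has_deriv_cvg => da db cb.
have l1 : (fun h => ip (h^-1 *: (a (t + h) - a t)) (b (t + h)) : R^o) @ (0 : R)^' -->
    (ip u (b t) : R^o).
  apply: (cvg_comp (fun h => (h^-1 *: (a (t + h) - a t), b (t + h)))
    (fun p : g * g => ip p.1 p.2 : R^o) _ (@ip_continuous _ _ _ _ ipP (u, b t))).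
  exact: (cvg_pair da cb).
have l2 : (fun h => ip (a t) (h^-1 *: (b (t + h) - b t)) : R^o) @ (0 : R)^' -->
    (ip (a t) v : R^o).
  apply: (cvg_comp (fun h => (a t, h^-1 *: (b (t + h) - b t)))
    (fun p : g * g => ip p.1 p.2 : R^o) _ (@ip_continuous _ _ _ _ ipP (a t, v))).
  exact: (cvg_pair (cvg_cst (a t)) db).
apply: (dnbhs0_cvg_eq _ (tvs_cvgD l1 l2)) => h _.
rewrite ipZl ipZr /GRing.scale /= -mulrDr; congr (_ * _).
by rewrite ipDl ipNl ipDr ipNr addrA subrK.
Qed.

Context (coad : g -> g -> g).
Hypothesis coadP : is_coad ip coad.

Lemma coadDl u1 u2 v : coad (u1 + u2) v = coad u1 v + coad u2 v.
Proof. by apply: ip_inj => w; rewrite coadP ipDl !coadP adDl ipDr. Qed.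

Lemma coadDr u v1 v2 : coad u (v1 + v2) = coad u v1 + coad u v2.
Proof. by apply: ip_inj => w; rewrite coadP !ipDl !coadP. Qed.

(** * Consequences of the skewness of [ad X] *)

Context (X : g) (J : set R) (gamma : R -> G).
Hypothesis coadX : forall v, coad X v = - ad X v.
Hypothesis oJ : open_interval J.
Hypothesis J0 : J 0.
Hypothesis flowX : is_flow X J gamma.

Lemma Ad_flow_isometry t u v : J t -> ip (Ad (gamma t) u) (Ad (gamma t) v) = ip u v.
Proof.
move=> Jt; have [_ iJ] := oJ; have [g0 _] := flowX.
have hR : hausdorff_space R^o by exact: Rhausdorff.
have dip s : J s ->
    has_deriv (fun r => ip (Ad (gamma r) u) (Ad (gamma r) v) : R^o) s 0.
  move=> Js.
  have du (w : g) := has_deriv_Ad_flow_cst (v := w) flowX Js.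
  have := has_deriv_ip (du u) (du v).
  suff -> : ip (ad X (Ad (gamma s) u)) (Ad (gamma s) v) +
    ip (Ad (gamma s) u) (ad X (Ad (gamma s) v)) = 0 by [].
  by rewrite -(coadP X) coadX ipNl addrN.
by rewrite (has_deriv0_constant hR iJ dip Jt J0) g0 !Ad1.
Qed.

(** Skewness turns the derivative of [ip (Ad (gamma t) X) X] into a pairing with [ad X X = 0], so
    this product stays [ip X X]. With the isometry property, the squared norm of
    [Ad (gamma t) X - X] vanishes on all of [J]. *)
Lemma Ad_flow_fix t : J t -> Ad (gamma t) X = X.
Proof.
move=> Jt; have [_ iJ] := oJ; have [g0 _] := flowX.
have hR : hausdorff_space R^o by exact: Rhausdorff.
have dip s : J s -> has_deriv (fun r => ip (Ad (gamma r) X) X : R^o) s 0.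
  move=> Js.
  have := has_deriv_ip (has_deriv_Ad_flow_cst (v := X) flowX Js) (has_deriv_cst X s).
  suff -> : ip (ad X (Ad (gamma s) X)) X + ip (Ad (gamma s) X) 0 = 0 by [].
  rewrite (ip_sym ipP _ 0) ip0l addr0 -[ad _ _]opprK -coadX ipNl coadP.
  by rewrite (ad_self oJ J0 flowX) (ip_sym ipP) ip0l oppr0.
have AX : ip (Ad (gamma t) X) X = ip X X.
  by rewrite (has_deriv0_constant hR iJ dip Jt J0) g0 Ad1.
apply/eqP; rewrite -subr_eq0; apply/negPn/negP => /(ip_pos ipP).
rewrite ipDl ipNl !ipDr !ipNr Ad_flow_isometry// (ip_sym ipP X (Ad _ _)) AX.
by rewrite !subrr ltxx.
Qed.

(** Test against vectors [Ad (gamma t) w], which are all vectors; [Ad] intertwines [ad] and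
    preserves [ip]. *)
Lemma coad_Ad_flow t u v : J t ->
  coad (Ad (gamma t) u) (Ad (gamma t) v) = Ad (gamma t) (coad u v).
Proof.
move=> Jt; apply: ip_inj => w; rewrite coadP -[w](AdVK (gamma t)).
by rewrite -Ad_ad !Ad_flow_isometry// coadP.
Qed.

End InnerProduct.

(** * The Euler-Arnold equation and stationarity in terms of [V] *)

Theorem theorem5p1 (R : realType) (E : tvsType R) (G : lieGroupType E)
    (ip : lie_algebra G -> lie_algebra G -> R)
    (Uexp : set (lie_algebra G)) (ex : lie_algebra G -> G)
    (coAd : G -> lie_algebra G -> lie_algebra G)
    (coad : lie_algebra G -> lie_algebra G -> lie_algebra G)
    (X : lie_algebra G) (J I : set R) (gamma : R -> G)
    (V : R -> lie_algebra G) :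
  inner_product ip ->
  riemannian_exp ip Uexp ex ->
  smooth_on (tvs_charts (lie_algebra G)) lie_charts Uexp ex ->
  local_diffeo_at0 Uexp ex ->
  is_coAd ip coAd ->
  is_coad ip coad ->
  (forall v, coad X v = - ad X v) ->
  open_interval J -> J 0 -> is_flow X J gamma ->
  open_interval I -> I `<=` J ->
  let U := fun t => X + Ad (gamma t) (V t) in
  (solves_on I (fun u => - coad u u) U <->
   solves_on I (fun v => - coad v v - coad v X) V) /\
  (stationary_on I U <-> solves_on I (fun v => coad X v) V).
Proof.
move=> ipP _ _ _ _ coadP coadX oJ J0 flowX [oI iI] IJ U.
have hE : hausdorff_space (lie_algebra G) := model_hausdorff (@lie_manifold R E G).
have AdB (s : G) (u v : lie_algebra G) : Ad s (u - v) = Ad s u - Ad s v.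
  by rewrite addrC -scaleN1r Ad_linear scaleN1r addrC.
have Ad0 (s : G) : Ad s 0 = 0 by have := AdB s 0 0; rewrite !subrr.
have AdN (s : G) (u : lie_algebra G) : Ad s (- u) = - Ad s u.
  by rewrite -sub0r AdB Ad0 sub0r.
have AdD (s : G) (u v : lie_algebra G) : Ad s (u + v) = Ad s u + Ad s v.
  by rewrite -{1}[v]opprK AdB AdN opprK.
have Ad_inj (s : G) : injective (Ad s) := can_inj (AdK s).
(* Every term is brought to the form [Ad (gamma t) _], so that injectivity of [Ad (gamma t)]
   compares the equations. *)
have AdXV t : I t -> ad X (Ad (gamma t) (V t)) = - Ad (gamma t) (coad X (V t)).
  move=> /IJ Jt; rewrite -(coad_Ad_flow ipP coadP coadX oJ J0 flowX)//.
  by rewrite (Ad_flow_fix ipP coadP coadX oJ J0 flowX)// coadX opprK.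
have UV t w : I t -> has_deriv V t w ->
    has_deriv U t (Ad (gamma t) (w - coad X (V t))).
  move=> It dV; have Jt := IJ _ It.
  have := has_derivD (has_deriv_cst X t) (has_deriv_Ad_flow flowX Jt dV).
  by rewrite add0r AdXV// addrC -AdB.
have VU t l : I t -> has_deriv U t l ->
    exists2 w, has_deriv V t w & l = Ad (gamma t) (w - coad X (V t)).
  move=> It dU; have Jt := IJ _ It.
  have [w dV] : exists w, has_deriv V t w.
    apply: (has_deriv_Ad_flowV flowX Jt (l := l)).
    have := has_derivD (has_deriv_cst (- X) t) dU.
    by rewrite add0r /U; under eq_fun do rewrite addKr.
  by exists w => //; apply: (has_deriv_unique hE dU); exact: UV.
(* Of the four terms of [coad (X + V t) (X + V t)], the one in [X] alone is [- ad X X = 0]. The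
   final [coad X (V t)] is the one occurring in [UV] and cancels. *)
have EA t : I t -> - coad (U t) (U t) =
    Ad (gamma t) ((- coad (V t) (V t) - coad (V t) X) - coad X (V t)).
  move=> /IJ Jt.
  have -> : U t = Ad (gamma t) (X + V t).
    by rewrite AdD (Ad_flow_fix ipP coadP coadX oJ J0 flowX Jt).
  rewrite (coad_Ad_flow ipP coadP coadX oJ J0 flowX)// -AdN.
  rewrite (coadDl ipP coadP) !(coadDr ipP coadP).
  rewrite coadX (ad_self oJ J0 flowX) oppr0 add0r opprD.
  by rewrite opprD addrC [- coad (V t) X + _]addrC.
split; split.
- move=> dU t It; have [w dV] := VU t _ It (dU t It).
  by rewrite EA// => /Ad_inj /addIr ->.
- by move=> dV t It; rewrite EA//; apply: UV => //; exact: dV.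
(* As [I] is open, a stationary [U] is constant near [t] and has derivative 0 there. *)
- move=> cU t It.
  have [|w dV] := VU t 0 It.
    apply: has_deriv_near (has_deriv_cst (U t) t); near=> s.
    apply: cU => //; near: s; exact: open_nbhs_nbhs.
  by rewrite -(Ad0 (gamma t)) => /Ad_inj/esym/eqP; rewrite subr_eq0 => /eqP <-.
- move=> dV s t; apply: (has_deriv0_constant hE iI) => r Ir.
  by have := UV r _ Ir (dV r Ir); rewrite subrr Ad0.
Unshelve. all: by end_near. Qed.
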